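(* Let $(\Omega,\mathcal{F})$ be a measurable space and $T:\Omega\to\Omega$ a measurable map. Let $\mathbb{V}(A)=\sup_{P\in\Theta}P(A)$, $A\in\mathcal{F}$, be an upper probability, where $\Theta=\{P \text{ probability on }(\Omega,\mathcal{F}) : P(A)\le \mathbb{V}(A)\ \forall A\in\mathcal{F}\}$. Assume $\mathbb{V}$ is continuous (from above), $T$-invariant, and $T$-ergodic. Let $\Theta_0$ be the set of $T$-invariant probabilities in $\Theta$, and let $\mathbb{E}^0[\eta]=\sup_{Q\in\Theta_0}E_Q[\eta]$ for bounded measurable $\eta$. Then for every $P\in\Theta$ and every bounded $\mathcal{F}$-measurable $\xi:\Omega\to\mathbb{R}$, the limit $\lim_{n\to\infty}\frac1n\sum_{k=0}^{n-1}\xi(T^k\omega)$ exists $P$-a.s. and $$-\mathbb{E}^0[-\xi]\le \lim_{n\to\infty}\frac1n\sum_{k=0}^{n-1}\xi(T^k\omega)\le \mathbb{E}^0[\xi],\quad P\text{-a.s.}$$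
   Context: $\mathcal{I}=\{A\in\mathcal{F}: T^{-1}A=A\}$ is the $T$-invariant $\sigma$-algebra. $\mathbb{V}$ is continuous if $\mathbb{V}(A_n)\to 0$ whenever $A_n\in\mathcal{F}$, $A_n\downarrow\emptyset$. $\mathbb{V}$ is $T$-invariant if $\mathbb{V}(T^{-1}A)=\mathbb{V}(A)$ for all $A\in\mathcal{F}$. A continuous upper probability $\mathbb{V}$ is $T$-ergodic if $\mathbb{V}(A)\in\{0,1\}$ for every $A\in\mathcal{I}$. A probability $P$ is $T$-invariant if $P(T^{-1}A)=P(A)$ for all $A\in\mathcal{F}$. *)

(* Defs.v *)
From HB Require Import structures.
From mathcomp Require Import all_boot all_order all_algebra.
From mathcomp Require Import all_classical all_reals all_analysis.
Set Implicit Arguments. Unset Strict Implicit. Unset Printing Implicit Defensive.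
Import Order.TTheory GRing.Theory Num.Theory.
Import numFieldNormedType.Exports.
Local Open Scope classical_set_scope.
Local Open Scope ring_scope.

Section UpperProb.
Context {d : measure_display} {Omega : measurableType d} {R : realType}.

Definition core (V : set Omega -> \bar R) : set (probability Omega R) :=
  [set P | forall A, measurable A -> (P A <= V A)%E].

Definition upper_probability (V : set Omega -> \bar R) : Prop :=
  forall A, measurable A -> V A = ereal_sup [set P A | P in core V].

Definition continuous_upper (V : set Omega -> \bar R) : Prop :=
  forall An : nat -> set Omega, (forall n, measurable (An n)) ->
    (forall n, An n.+1 `<=` An n) -> \bigcap_n An n = set0 ->
    V (An n) @[n --> \oo] --> 0%E.

Definition T_invariant_V (T : Omega -> Omega) (V : set Omega -> \bar R) : Prop :=
  forall A, measurable A -> V (T @^-1` A) = V A.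

Definition invariant_set (T : Omega -> Omega) (A : set Omega) : Prop :=
  measurable A /\ T @^-1` A = A.

Definition T_ergodic (T : Omega -> Omega) (V : set Omega -> \bar R) : Prop :=
  forall A, invariant_set T A -> V A = 0%E \/ V A = 1%E.

Definition T_invariant_prob (T : Omega -> Omega) (P : probability Omega R) : Prop :=
  forall A, measurable A -> P (T @^-1` A) = P A.

Definition core0 (T : Omega -> Omega) (V : set Omega -> \bar R) :
  set (probability Omega R) := [set Q | core V Q /\ T_invariant_prob T Q].

Definition E0 (T : Omega -> Omega) (V : set Omega -> \bar R) (eta : Omega -> R) : \bar R :=
  ereal_sup [set (\int[Q]_x (eta x)%:E)%E | Q in core0 T V].

Definition erg_avg (T : Omega -> Omega) (xi : Omega -> R) (w : Omega) (n : nat) : R :=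
  n%:R^-1 * \sum_(k < n) xi (iter k T w).

End UpperProb.

(* Main.v *)
Require Import Defs.
From HB Require Import structures.
From mathcomp Require Import all_boot all_order all_algebra.
From mathcomp Require Import all_classical all_reals all_analysis.
From mathcomp Require Import measurable_realfun.
From mathcomp Require Import ring lra.
Import Order.TTheory GRing.Theory Num.Theory.
Import numFieldNormedType.Exports.
Local Open Scope classical_set_scope.
Local Open Scope ring_scope.

(* Let P be in the core of V. The Cesaro means of the measures P o T^-k are all
   dominated by V; their limit along an ultrafilter is a finitely additive set
   function Q that is T-invariant, dominated by V and equal to P on invariant
   sets, and continuity of V makes Q sigma-additive, hence a member of core0.
   The maximal ergodic lemma for Q shows that on an invariant set A where the
   limsup of the averages of xi is > c, the Q-integral of (xi - c) 1_A is
   nonnegative. Applied to xi and - xi it shows that the sets where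
   liminf < a < b < limsup are Q-null, hence P-null since they are invariant.
   If V {limsup > c} were 1, members of the core would give {limsup > c} mass
   arbitrarily close to 1, and so would the corresponding Q, forcing
   E0 xi >= c; hence by ergodicity V {limsup > c} = 0 as soon as c > E0 xi. *)

(** * Limits along ultrafilters, and probabilities built from set functions *)

Lemma fmap_ultra (I J : Type) (U : set_system I) (f : I -> J) :
  UltraFilter U -> UltraFilter (f @ U).
Proof.
move=> UU; split; first exact: fmap_proper_filter.
move=> G PG fUG; apply/seteqP; split => // A GA.
have [//|UnA] := @in_ultra_setVsetC _ U (f @^-1` A) UU.
have GnA : G (~` A) by apply: fUG.
have : G set0 by rewrite -(setICr A); exact: filterI.
by move/filter_not_empty.
Qed.

(** The image of [U] under [u] is an ultrafilter containing the compact segment [[-M, M]], hence it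
    converges there. *)
Lemma bounded_cvg_ultra (R : realType) (I : Type) (U : set_system I)
    (u : I -> R) (M : R) :
  UltraFilter U -> (forall i, `|u i| <= M) -> cvg (u @ U).
Proof.
move=> UU uM; have := @segment_compact R (- M) M.
rewrite compact_ultra => /(_ _ (@fmap_ultra _ _ U u UU))[].
  by apply: (@filterE _ U) => i /=; rewrite in_itv/= -ler_norml.
by move=> l [_ ul]; apply/cvg_ex; exists l.
Qed.

Lemma exists_probability (d : measure_display) (Omega : measurableType d)
    (R : realType) (mu : set Omega -> \bar R) :
  mu set0 = 0%E -> (forall A, 0 <= mu A)%E -> semi_sigma_additive mu ->
  mu setT = 1%E -> exists Q : probability Omega R, forall A, Q A = mu A.
Proof.
move=> mu0 muge0 sigma_mu muT.
pose H1 := isMeasure.Build d Omega R mu mu0 muge0 sigma_mu.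
pose m : {measure set Omega -> \bar R} := HB.pack mu H1.
pose H2 := Measure_isProbability.Build d Omega R m muT.
pose Q : probability Omega R := HB.pack mu H1 H2.
by exists Q.
Qed.

(** * Real sequences: limsup conditions and a convergence criterion *)

(** Without the slack, a sequence decreasing strictly to [c] would qualify, and the property would
    not survive adding a sequence that tends to 0. *)
Definition often_gt {R : realType} (u : nat -> R) (c : R) : Prop :=
  exists k : nat, forall N : nat, exists2 n, (N <= n)%N & c + k.+1%:R^-1 < u n.

Lemma often_gtW (R : realType) (u : nat -> R) (b c : R) : c < b ->
  (forall N, exists2 n, (N <= n)%N & b < u n) -> often_gt u c.
Proof.
move=> cb ub; have /ltr_add_invr[k ckb] := cb.
by exists k => N; have [n Nn bn] := ub N; exists n => //; exact: lt_trans bn.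
Qed.

Lemma not_frequently_gt (R : realType) (u : nat -> R) (b : R) :
  ~ (forall N, exists2 n, (N <= n)%N & b < u n) ->
  exists N, forall n, (N <= n)%N -> u n <= b.
Proof.
move=> nub; apply: contrapT => nN; apply: nub => N; apply: contrapT => nn.
apply: nN; exists N => n Nn; rewrite leNgt; apply/negP => bn.
by apply: nn; exists n.
Qed.

Lemma cvg_often_gt (R : realType) (u : nat -> R) (l c : R) :
  u @ \oo --> l -> c < l -> often_gt u c.
Proof.
move=> ul cl; apply: (@often_gtW _ _ ((c + l) / 2)); first lra.
move=> N; have cl2 : (c + l) / 2 < l by lra.
have [N0 _ uN0] := cvgr_gt _ ul _ cl2.
by exists (maxn N N0); [exact: leq_maxl|apply: uN0 => /=; exact: leq_maxr].
Qed.

(** Half of the slack of [u] absorbs the eventual difference with [v]; the other half remains as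
    slack for [v]. *)
Lemma often_gt_cvg0 (R : realType) (u v : nat -> R) (c : R) :
  (u n - v n) @[n --> \oo] --> (0 : R) -> often_gt u c -> often_gt v c.
Proof.
move=> uv0 [k uk].
apply: (@often_gtW _ _ (c + k.+1%:R^-1 / 2)); first by rewrite ltrDl divr_gt0.
have k2 : 0 < (k.+1%:R^-1 / 2 : R) by rewrite divr_gt0.
move=> N; have [N0 _ uvN0] := cvgr_lt _ uv0 _ k2.
have [n Nn un] := uk (maxn N N0).
exists n; first exact: leq_trans (leq_maxl _ _) Nn.
have /= := uvN0 n (leq_trans (leq_maxr _ _) Nn).
move: k2 un; set e := _^-1; lra.
Qed.

Lemma bounded_not_often_cvg (R : realType) (u : nat -> R) (M : R) :
  (forall n, `|u n| <= M) ->
  (forall a b : rat, a < b ->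
    ~ (often_gt u (ratr b) /\ often_gt (fun n => - u n) (- ratr a))) ->
  cvgn u.
Proof.
move=> uM nosc.
(* [S] collects the eventual upper bounds of [u], so [inf S] is its limsup, the limit to be
   proved. *)
pose S := [set x | exists N, forall n, (N <= n)%N -> u n <= x].
have SM : S M by exists 0%N => n _; exact: le_trans (ler_norm _) (uM n).
have lbS : has_lbound S.
  exists (- M) => x [N uN]; apply: le_trans (uN N (leqnn _)).
  by have := uM N; rewrite ler_norml => /andP[].
have hS : has_inf S by split=> //; exists M.
apply/cvg_ex; exists (inf S); apply/cvgrPdist_lt => e e0.
have [x [N1 uN1] xlt] := inf_adherent e0 hS.
(* Both rationals lie within [e] below the limsup. As [u] often exceeds [b], [nosc] prevents it from
   often dropping below [a], so [u] eventually stays above [inf S - e]. *)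
have [b /andP[b1 b2]] : exists b : rat, (inf S - e / 2 < ratr b < inf S).
  have [|b] := @rat_in_itvoo R (inf S - e / 2) (inf S); first by lra.
  by rewrite in_itv /=; exists b.
have [a /andP[a1 a2]] : exists a : rat, (inf S - e < ratr a < inf S - e / 2).
  have [|a] := @rat_in_itvoo R (inf S - e) (inf S - e / 2); first by lra.
  by rewrite in_itv /=; exists a.
have ab : a < b by rewrite -(ltr_rat R); exact: lt_trans b1.
have ub : often_gt u (ratr b).
  apply: (@often_gtW _ _ ((ratr b + inf S) / 2)); first lra.
  apply: contrapT => /not_frequently_gt[N uN].
  have : inf S <= (ratr b + inf S) / 2 by apply: ge_inf => //; exists N.
  lra.
have [N2 uN2] : exists N, forall n, (N <= n)%N ->
    - u n <= - ((ratr a + (inf S - e)) / 2).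
  apply: (@not_frequently_gt _ (fun n => - u n)) => h.
  apply: (nosc a b ab); split=> //; apply: often_gtW h; lra.
exists (maxn N1 N2) => // n /=; rewrite geq_max => /andP[n1 n2].
have := uN1 _ n1; have := uN2 _ n2; rewrite ltr_norml => ? ?.
apply/andP; split; lra.
Qed.

(** Since [0^-1 = 0], the bound at [n = 0] forces [u 0 = 0]; differences of empty averages satisfy
    this. *)
Lemma cvg0_le_invn (R : realType) (u : nat -> R) (C : R) :
  (forall n, `|u n| <= C * n%:R^-1) -> u @ \oo --> (0 : R).
Proof.
move=> uC; have n0 : (n%:R^-1 : R) @[n --> \oo] --> (0 : R).
  apply/gtr0_cvgV0; last exact: cvgr_idn.
  by near=> n; rewrite ltr0n; near: n; exact: nbhs_infty_gt.
have Cn0 : C * n%:R^-1 @[n --> \oo] --> (0 : R).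
  by rewrite -(mulr0 C); apply: cvgM => //; exact: cvg_cst.
apply: norm_cvg0; apply: (@squeeze_cvgr _ _ _ _ (cst 0) (fun n => C * n%:R^-1)) => //.
  by apply: nearW => n; rewrite normr_ge0 uC.
exact: cvg_cst.
Unshelve. all: end_near. Qed.

(** * Measurability of iterates, and sigma-additivity from continuity of [V] *)

Lemma measurable_iter (d : measure_display) (Omega : measurableType d)
    (T : Omega -> Omega) (k : nat) :
  measurable_fun setT T -> measurable_fun setT (iter k T).
Proof.
move=> mT; elim: k => [|k IH]; first exact: measurable_id.
by apply: (measurableT_comp mT).
Qed.

Lemma measurable_preimage (d : measure_display) (Omega : measurableType d)
    (T : Omega -> Omega) (A : set Omega) :
  measurable_fun setT T -> measurable A -> measurable (T @^-1` A).
Proof. by move=> mT mA; rewrite -[X in measurable X]setTI; exact: mT. Qed.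

Lemma fine_probability_le1 (d : measure_display) (Omega : measurableType d)
    (R : realType) (P : probability Omega R) (A : set Omega) :
  measurable A -> 0 <= fine (P A) <= 1.
Proof.
move=> mA; rewrite fine_ge0// -lee_fin fineK ?fin_num_measure//.
exact: probability_le1.
Qed.

(** The tails [D n] of a disjoint union decrease to the empty set, so [L (D n) <= V (D n)] tends to
    0; by finite additivity this is the error of the [n]-th partial sum. *)
Lemma semi_sigma_additive_dominated (d : measure_display)
    (Omega : measurableType d) (R : realType) (V : set Omega -> \bar R)
    (L : set Omega -> R) :
  continuous_upper V -> (forall A, 0 <= L A) -> L set0 = 0 ->
  (forall A, measurable A -> ((L A)%:E <= V A)%E) ->
  (forall A B, measurable A -> measurable B -> A `&` B = set0 ->
    L (A `|` B) = L A + L B) ->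
  semi_sigma_additive (fun A => (L A)%:E).
Proof.
move=> cV L_ge0 L0 LV LD F mF tF mUF.
pose B n := \big[setU/set0]_(0 <= i < n) F i.
have mB n : measurable (B n) by apply: bigsetU_measurable => i _; exact: mF.
have LB n : L (B n) = \sum_(0 <= i < n) L (F i).
  elim: n => [|n IH]; first by rewrite /B !big_geq.
  rewrite /B !big_nat_recr//= -/(B n) LD//; first by rewrite IH.
  rewrite setIC /B big_mkord big_distrr/= big1// => i _.
  move/trivIsetP : tF => /(_ n i Logic.I Logic.I); apply.
  by rewrite neq_ltn ltn_ord orbT.
pose D n := (\bigcup_n F n) `\` B n.
have mD n : measurable (D n) by exact: measurableD.
have LE n : \sum_(0 <= i < n) L (F i) = L (\bigcup_n F n) - L (D n).
  have -> : \bigcup_n F n = B n `|` D n.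
    rewrite setDUK// /B big_mkord -bigcup_mkord.
    by apply: bigcup_sub => i _; exact: bigcup_sup.
  by rewrite LD// ?setDIK// -LB addrK.
have LD0 : L (D n) @[n --> \oo] --> (0 : R).
  have : (L (D n))%:E @[n --> \oo] --> 0%E.
    apply: (@squeeze_cvge _ _ _ _ (cst 0%E) _ (V \o D)).
    - by apply: nearW => n /=; rewrite lee_fin L_ge0 LV.
    - exact: cvg_cst.
    - apply: cV => // [n x [Fx nBx]|].
        by split=> // Bx; apply: nBx; rewrite /B big_nat_recr//=; left.
      rewrite -subset0 => x Dx; have [[i _ Fix] _] := Dx 0%N Logic.I.
      have [_] := Dx i.+1 Logic.I; apply.
      by rewrite /B big_nat_recr//=; right.
  by move/fine_cvgP => [].
rewrite (_ : (fun n => _) = (fun n => (L (\bigcup_n F n) - L (D n))%:E)); last first.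
  by apply/funext => n; rewrite sumEFin LE.
apply: cvg_EFin; first by exact: nearW.
rewrite -[X in _ --> X]subr0; apply: cvgB => //; exact: cvg_cst.
Qed.

(** * Cesaro means of the measures [P o T^-k], and an invariant member of the core *)

Definition cesaro_measure {d : measure_display} {Omega : measurableType d}
    {R : realType} (T : Omega -> Omega) (P : probability Omega R)
    (A : set Omega) (n : nat) : R :=
  n%:R^-1 * \sum_(k < n) fine (P (iter k T @^-1` A)).

Section cesaro_measure.
Context {d : measure_display} {Omega : measurableType d} {R : realType}.
Context (T : Omega -> Omega) (V : set Omega -> \bar R).
Context (mT : measurable_fun setT T) (P : probability Omega R).

Local Notation q := (cesaro_measure T P).

Let mTk k A : measurable A -> measurable (iter k T @^-1` A).
Proof. by move=> mA; apply: measurable_preimage => //; exact: measurable_iter. Qed.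

Lemma cesaro_le (p : nat -> R) (v : R) (n : nat) : (0 < n)%N ->
  (forall k, p k <= v) -> n%:R^-1 * \sum_(k < n) p k <= v.
Proof.
move=> n0 pv; rewrite mulrC ler_pdivrMr ?ltr0n// mulr_natr.
by rewrite -[n in leRHS]card_ord -sumr_const; exact: ler_sum.
Qed.

Lemma cesaro_cst (p : nat -> R) (v : R) (n : nat) : (0 < n)%N ->
  (forall k, p k = v) -> n%:R^-1 * \sum_(k < n) p k = v.
Proof.
move=> n0 pv; under eq_bigr do rewrite pv.
by rewrite sumr_const card_ord -[v *+ n]mulr_natl mulKf// pnatr_eq0 -lt0n.
Qed.

Lemma cesaro_measure_ge0 A n : 0 <= q A n.
Proof. by rewrite mulr_ge0 ?invr_ge0// sumr_ge0// => k _; exact: fine_ge0. Qed.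

Lemma cesaro_measure_le1 A n : measurable A -> q A n <= 1.
Proof.
move=> mA; case: n => [|n]; first by rewrite /cesaro_measure big_ord0 mulr0.
by apply: (@cesaro_le (fun k => fine (P (iter k T @^-1` A)))) => // k;
  have /andP[] := fine_probability_le1 _ _ _ P _ (mTk k A mA).
Qed.

Lemma cesaro_measureU A B n : measurable A -> measurable B -> A `&` B = set0 ->
  q (A `|` B) n = q A n + q B n.
Proof.
move=> mA mB AB0; rewrite /cesaro_measure -mulrDr -big_split/=; congr (_ * _).
apply: eq_bigr => k _; rewrite preimage_setU measureU//; try exact: mTk.
- by rewrite fineD// fin_num_measure//; exact: mTk.
- by rewrite -preimage_setI AB0 preimage_set0.
Qed.

(** The sum telescopes to two boundary terms in [[0, 1]], so the difference is at most [1 / n] in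
    absolute value. *)
Lemma cesaro_measure_shift A : measurable A ->
  q (T @^-1` A) n - q A n @[n --> \oo] --> (0 : R).
Proof.
move=> mA.
have qE n : q (T @^-1` A) n - q A n =
    n%:R^-1 * (fine (P (iter n T @^-1` A)) - fine (P A)).
  rewrite /cesaro_measure -mulrBr; congr (_ * _).
  have -> : \sum_(k < n) fine (P (iter k T @^-1` (T @^-1` A))) =
      \sum_(k < n) fine (P (iter k.+1 T @^-1` A)) by [].
  rewrite -sumrB -(big_mkord xpredT
    (fun k => fine (P (iter k.+1 T @^-1` A)) - fine (P (iter k T @^-1` A)))).
  by rewrite telescope_sumr.
under eq_fun do rewrite qE.
apply: (@cvg0_le_invn _ _ 1) => n; rewrite mul1r normrM ger0_norm ?invr_ge0//.
rewrite ler_piMr ?invr_ge0// ler_norml.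
have /andP[a0 a1] := fine_probability_le1 _ _ _ P _ (mTk n A mA).
have /andP[b0 b1] := fine_probability_le1 _ _ _ P _ mA.
by apply/andP; split; lra.
Qed.

Lemma preimage_iter_invariant A k : T @^-1` A = A -> iter k T @^-1` A = A.
Proof.
move=> TA; elim: k => // k IH.
by rewrite -[LHS]/(iter k T @^-1` (T @^-1` A)) TA.
Qed.

Lemma core_preimage_iter A k : T_invariant_V T V -> core V P -> measurable A ->
  (P (iter k T @^-1` A) <= V A)%E.
Proof.
move=> iV PV mA; apply: (le_trans (PV _ (mTk k A mA))).
elim: k A mA => // k IH A mA.
rewrite -[iter _ _ @^-1` _]/(iter k T @^-1` (T @^-1` A)) -(iV A)//.
by apply: IH; exact: measurable_preimage.
Qed.

(* [L] is forced to be [0] on nonmeasurable sets, where [P] is unspecified and the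
   Cesaro means need not be bounded. *)
Lemma invariant_core : continuous_upper V -> T_invariant_V T V -> core V P ->
  exists2 Q : probability Omega R, core0 T V Q &
    forall A, invariant_set T A -> Q A = P A.
Proof.
move=> cV iV PV.
have [U [UU ooU]] := @ultraFilterLemma nat \oo _.
pose L A : R := if `[< measurable A >] then lim (q A @ U) else 0.
have LE A : measurable A -> L A = lim (q A @ U) by rewrite /L => mA; rewrite asboolT.
have qL A : measurable A -> q A @ U --> L A.
  move=> mA; rewrite LE//; apply: (@bounded_cvg_ultra _ _ _ _ 1) => n.
  by rewrite ger0_norm ?cesaro_measure_le1 ?cesaro_measure_ge0.
(* The mean at [n = 0] is 0, so the expected values hold only for [n > 0]. Since [U] refines [\oo],
   eventual values still determine the limit. *)
have Lu A l : measurable A -> (\forall n \near \oo, q A n = l) -> L A = l.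
  move=> mA ql; apply: (cvg_unique _ (qL A mA)) => //.
  by apply: (cvg_trans (cvg_app (q A) ooU)); exact: cvg_near_cst.
have L_ge0 A : 0 <= L A.
  have [mA|mA] := pselect (measurable A); last by rewrite /L asboolF.
  rewrite LE//; apply: limr_ge; first by apply/cvg_ex; exists (L A); exact: qL.
  by apply: filterE => n; exact: cesaro_measure_ge0.
have L0 : L set0 = 0.
  apply: Lu => //; apply: nearW => n; rewrite /cesaro_measure big1 ?mulr0// => k _.
  by rewrite preimage_set0 measure0.
have LT : L setT = 1.
  apply: Lu => //; near=> n.
  apply: (@cesaro_cst (fun k => fine (P (iter k T @^-1` setT)))).
    by near: n; exact: nbhs_infty_gt.
  by move=> k; rewrite preimage_setT probability_setT.
have LD A B : measurable A -> measurable B -> A `&` B = set0 ->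
    L (A `|` B) = L A + L B.
  move=> mA mB AB0; apply: (cvg_unique _ (qL (A `|` B) (measurableU _ _ mA mB))) => //.
  rewrite (_ : q (A `|` B) = q A \+ q B).
    by apply: cvgD; exact: qL.
  by apply/funext => n /=; exact: cesaro_measureU.
have LV A : measurable A -> ((L A)%:E <= V A)%E.
  move=> mA; move: (fun k => core_preimage_iter A k iV PV mA).
  (* [V A] is an extended real: [+oo] is a trivial bound, and [-oo] cannot bound [P A >= 0]. *)
  case: (V A) => [v| |] pv; [|by rewrite leey|].
    rewrite lee_fin LE//; apply: limr_le.
      by apply/cvg_ex; exists (L A); exact: qL.
    apply: ooU; near=> n.
    apply: (@cesaro_le (fun k => fine (P (iter k T @^-1` A)))).
      by near: n; exact: nbhs_infty_gt.
    by move=> k; rewrite -lee_fin fineK ?fin_num_measure//; exact: mTk.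
  by have := le_trans (measure_ge0 _ _) (pv 0%N); rewrite leeNy_eq.
have [Q QE] : exists Q : probability Omega R, forall A, Q A = (L A)%:E.
  apply: exists_probability => //; [by rewrite L0| |by rewrite LT].
  exact: semi_sigma_additive_dominated cV _ _ _ _.
exists Q; first split.
- by move=> A mA; rewrite QE LV.
- move=> A mA; rewrite !QE; congr EFin.
  have mTA : measurable (T @^-1` A) by exact: measurable_preimage.
  apply/eqP; rewrite -subr_eq0; apply/eqP.
  apply: (cvg_unique _ (cvgB (qL _ mTA) (qL _ mA))) => //.
  apply: cvg_trans (cesaro_measure_shift A mA).
  exact: cvg_app ooU.
- move=> A [mA TA]; rewrite QE -[RHS]fineK ?fin_num_measure//; congr EFin.
  apply: Lu => //; near=> n.
  apply: (@cesaro_cst (fun k => fine (P (iter k T @^-1` A)))).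
    by near: n; exact: nbhs_infty_gt.
  by move=> k; rewrite preimage_iter_invariant.
Unshelve. all: end_near. Qed.

End cesaro_measure.

(** * Integration of bounded functions and the maximal ergodic lemma *)

Lemma bounded_integrable (d : measure_display) (Omega : measurableType d)
    (R : realType) (Q : probability Omega R) (g : Omega -> R) (M : R) :
  measurable_fun setT g -> (forall w, `|g w| <= M) ->
  Q.-integrable setT (EFin \o g).
Proof.
move=> mg gM; apply: measurable_bounded_integrable => //.
  by rewrite -ge0_fin_numE //; exact: fin_num_measure.
exists M; split; first exact: num_real.
by move=> x Mx w _ /=; exact: le_trans (gM w) (ltW Mx).
Qed.

Lemma ge0_integral_comp_invariant (d : measure_display)
    (Omega : measurableType d) (R : realType) (T : Omega -> Omega)
    (Q : probability Omega R) (g : Omega -> R) :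
  measurable_fun setT T -> T_invariant_prob T Q -> measurable_fun setT g ->
  (forall w, 0 <= g w) ->
  (\int[Q]_w (g (T w))%:E = \int[Q]_w (g w)%:E)%E.
Proof.
move=> mT iQ mg g0.
have := @ge0_integral_pushforward _ _ _ _ R T mT Q setT (EFin \o g).
rewrite preimage_setT => <- //; last 2 first.
- exact/measurable_EFinP.
- by move=> w _; rewrite lee_fin.
by apply: eq_measure_integral => A mA _; exact: iQ.
Qed.

(* Equals the maximum over [k <= n] of the Birkhoff sums of [f] of length [k]. *)
Fixpoint max_birkhoff {R : realType} {Omega : Type} (T : Omega -> Omega)
    (f : Omega -> R) (n : nat) (w : Omega) : R :=
  if n is m.+1 then Num.max 0 (f w + max_birkhoff T f m (T w)) else 0.

Section maximal_ergodic.
Context {d : measure_display} {Omega : measurableType d} {R : realType}.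
Context (T : Omega -> Omega) (mT : measurable_fun setT T).
Context (f : Omega -> R) (mf : measurable_fun setT f).
Context (C : R) (fC : forall w, `|f w| <= C).

Local Notation M := (max_birkhoff T f).

Lemma max_birkhoff_ge0 n w : 0 <= M n w.
Proof. by case: n => //= n; rewrite le_max lexx. Qed.

Lemma max_birkhoffS n w : M n w <= M n.+1 w.
Proof.
elim: n w => [|n IH] w; first exact: max_birkhoff_ge0.
by rewrite [leLHS]/= [leRHS]/= ge_max !le_max lexx/= lerD2l IH orbT.
Qed.

Lemma max_birkhoff_homo m n w : (m <= n)%N -> M m w <= M n w.
Proof.
move=> mn; rewrite -(subnKC mn); elim: (n - m)%N => [|k IH]; first by rewrite addn0.
by rewrite addnS; exact: le_trans IH (max_birkhoffS _ _).
Qed.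

Lemma birkhoff_le_max n w : \sum_(k < n) f (iter k T w) <= M n w.
Proof.
elim: n w => [|n IH] w; first by rewrite big_ord0.
rewrite big_ord_recl (eq_bigr (fun k : 'I_n => f (iter k T (T w)))); last first.
  by move=> k _; rewrite -iterSr.
by rewrite [leRHS]/= le_max lerD2l IH orbT.
Qed.

Lemma max_birkhoff_le n w : M n w <= n%:R * C.
Proof.
have C0 : 0 <= C by exact: le_trans (fC w).
elim: n w => [|n IH] w /=; first by rewrite mul0r.
rewrite ge_max mulr_ge0//= -natr1 mulrDl mul1r addrC lerD//.
exact: le_trans (ler_norm _) (fC w).
Qed.

Lemma measurable_max_birkhoff n : measurable_fun setT (M n).
Proof.
elim: n => [|n IH] /=; first exact: measurable_cst.
apply: (@measurable_maxr _ _ _ _ (cst 0) (fun w => f w + M n (T w))).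
  exact: measurable_cst.
by apply: measurable_funD => //; exact: measurableT_comp.
Qed.

Lemma measurable_max_birkhoff_gt0 n : measurable [set w | 0 < M n w].
Proof.
rewrite -[X in measurable X]setTI.
apply: (@measurable_fun_ltr _ _ _ _ (cst 0) (M n) _ _ measurableT [set true]) => //.
exact: measurable_max_birkhoff.
Qed.

Context (Q : probability Omega R) (iQ : T_invariant_prob T Q).

(** Garsia's argument: the integrand dominates [M n - M n o T], whose integral is 0 by invariance of
    [Q]. *)
Lemma maximal_ergodic_lemma n :
  (0 <= \int[Q]_w (f w * \1_[set w | 0 < M n w] w)%:E)%E.
Proof.
case: n => [|n].
  rewrite (_ : [set _ | _] = set0); last by apply/seteqP; split => w //=; rewrite ltxx.
  by under eq_integral do rewrite indic0 mulr0; rewrite integral0.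
have iM : Q.-integrable setT (EFin \o M n.+1).
  apply: (@bounded_integrable _ _ _ _ _ (n.+1%:R * C)) => [|w].
    exact: measurable_max_birkhoff.
  by rewrite ger0_norm ?max_birkhoff_ge0// max_birkhoff_le.
have iMT : Q.-integrable setT (EFin \o (M n.+1 \o T)).
  apply: (@bounded_integrable _ _ _ _ _ (n.+1%:R * C)) => [|w].
    by apply: measurableT_comp => //; exact: measurable_max_birkhoff.
  by rewrite ger0_norm ?max_birkhoff_ge0// max_birkhoff_le.
have : (\int[Q]_w ((M n.+1 w)%:E - ((M n.+1 \o T) w)%:E) = 0)%E.
  rewrite integralB_EFin//.
  have /= -> := ge0_integral_comp_invariant _ _ _ _ _ _ mT iQ
    (measurable_max_birkhoff n.+1) (max_birkhoff_ge0 n.+1).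
  by rewrite subee//; exact: integrable_fin_num.
move=> <-; apply: le_integral => //.
- exact: integrableB.
- apply: (@bounded_integrable _ _ _ _ _ C) => [|w].
    apply: measurable_funM => //; apply: measurable_indic.
    exact: measurable_max_birkhoff_gt0.
  rewrite normrM (le_trans _ (fC w))// ler_piMr// indicE.
  by case: (_ \in _); rewrite ?normr1 ?normr0.
- (* Where [M n.+1 w > 0], [f w = M n.+1 w - M n (T w)]. *)
  move=> w _; rewrite -EFinB lee_fin indicE.
  have := max_birkhoff_ge0 n.+1 (T w); have := max_birkhoffS n (T w).
  have := erefl (M n.+1 w); rewrite {2}[M n.+1 w]/= [(M n.+1 \o T) w]/comp.
  have := max_birkhoff_ge0 n.+1 w.
  case: (boolP (w \in _)) => [|/negP]; rewrite inE /mkset.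
    move: (M n.+1 w) (M n.+1 (T w)) (M n (T w)) => a b c.
    rewrite mulr1 /Num.max; case: ifPn => _; lra.
  move=> /negP; rewrite -leNgt mulr0.
  by move: (M n.+1 w) (M n.+1 (T w)) (M n (T w)) => a b c; lra.
Qed.

(** The sets where [M n > 0] increase with [n] and eventually contain each point where [f] is
    nonzero, so dominated convergence removes the indicator from the previous inequality. *)
Lemma maximal_ergodic :
  (forall w, f w != 0 -> exists n, 0 < \sum_(k < n) f (iter k T w)) ->
  (0 <= \int[Q]_w (f w)%:E)%E.
Proof.
move=> fsum.
have mfn n : measurable_fun setT (fun w => (f w * \1_[set w | 0 < M n w] w)%:E).
  apply/measurable_EFinP; apply: measurable_funM => //; apply: measurable_indic.
  exact: measurable_max_birkhoff_gt0.
have [||||_ _ +] := @dominated_convergence _ _ R Q setT measurableT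
  (fun n w => (f w * \1_[set w | 0 < M n w] w)%:E) (EFin \o f) (cst C%:E) mfn.
- exact/measurable_EFinP.
- apply: aeW => w _; apply: cvg_near_cst.
  have [fw0|/fsum[N sN]] := eqVneq (f w) 0.
    by apply: nearW => n; rewrite /= fw0 mul0r.
  exists N => // n /= Nn; rewrite indicE mem_set ?mulr1//=.
  apply: lt_le_trans (max_birkhoff_homo _ _ _ Nn).
  exact: lt_le_trans (birkhoff_le_max _ _).
- by apply: finite_measure_integrable_cst.
- apply: aeW => w n _; rewrite lee_fin normrM (le_trans _ (fC w))// ler_piMr// indicE.
  by case: (_ \in _); rewrite ?normr1 ?normr0.
move=> If; rewrite -(cvg_lim _ If)//; apply: lime_ge.
  by apply/cvg_ex; eexists; exact: If.
by apply: nearW => n; exact: maximal_ergodic_lemma.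
Qed.

End maximal_ergodic.

(* The slack [1 / k.+1] built into [often_gt] makes this the set where the limsup
   of the ergodic averages is [> c], and makes it invariant under [T]. *)
Definition limsup_gt {d : measure_display} {Omega : measurableType d}
    {R : realType} (T : Omega -> Omega) (xi : Omega -> R) (c : R) : set Omega :=
  [set w | often_gt (erg_avg T xi w) c].

Lemma erg_avgN (d : measure_display) (Omega : measurableType d) (R : realType)
    (T : Omega -> Omega) (xi : Omega -> R) (w : Omega) (n : nat) :
  erg_avg T (fun x => - xi x) w n = - erg_avg T xi w n.
Proof. by rewrite /erg_avg sumrN mulrN. Qed.

(** * Ergodic averages under an invariant probability *)

Section birkhoff.
Context {d : measure_display} {Omega : measurableType d} {R : realType}.
Context (T : Omega -> Omega) (mT : measurable_fun setT T).

Lemma measurable_erg_avg (xi : Omega -> R) (n : nat) : measurable_fun setT xi ->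
  measurable_fun setT (fun w => erg_avg T xi w n).
Proof.
move=> mxi; apply: measurable_funM => //; apply: measurable_sum => k.
by apply: measurableT_comp => //; exact: measurable_iter.
Qed.

Lemma erg_avg_le (xi : Omega -> R) (M : R) (w : Omega) (n : nat) :
  (forall w, `|xi w| <= M) -> `|erg_avg T xi w n| <= M.
Proof.
move=> xiM; case: n => [|n].
  by rewrite /erg_avg big_ord0 mulr0 normr0; exact: le_trans (xiM w).
rewrite /erg_avg normrM ger0_norm ?invr_ge0//.
apply: (@le_trans _ _ (n.+1%:R^-1 * \sum_(k < n.+1) `|xi (iter k T w)|)).
  by rewrite ler_wpM2l ?invr_ge0// ler_norm_sum.
by apply: (@cesaro_le _ (fun k => `|xi (iter k T w)|)).
Qed.

Lemma erg_avg_shift (xi : Omega -> R) (M : R) (w : Omega) :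
  (forall w, `|xi w| <= M) ->
  erg_avg T xi (T w) n - erg_avg T xi w n @[n --> \oo] --> (0 : R).
Proof.
move=> xiM; apply: (@cvg0_le_invn _ _ (M + M)) => n.
have -> : erg_avg T xi (T w) n - erg_avg T xi w n =
    (xi (iter n T w) - xi w) * n%:R^-1.
  rewrite /erg_avg -mulrBr mulrC; congr (_ * _).
  rewrite -sumrB (eq_bigr (fun k : 'I_n => xi (iter k.+1 T w) - xi (iter k T w))).
    rewrite -(big_mkord xpredT (fun k => xi (iter k.+1 T w) - xi (iter k T w))).
    by rewrite telescope_sumr.
  by move=> k _; rewrite iterSr.
rewrite normrM [X in _ * X]ger0_norm ?invr_ge0// ler_wpM2r ?invr_ge0//.
by rewrite (le_trans (ler_normB _ _))// lerD.
Qed.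

Lemma measurable_limsup_gt (xi : Omega -> R) (c : R) : measurable_fun setT xi ->
  measurable (limsup_gt T xi c).
Proof.
move=> mxi.
have -> : limsup_gt T xi c = \bigcup_k \bigcap_N \bigcup_(n in [set n | (N <= n)%N])
    [set w | c + k.+1%:R^-1 < erg_avg T xi w n].
  apply/seteqP; split => w.
    by move=> [k uk]; exists k => // N _; have [n Nn un] := uk N; exists n.
  by move=> [k _ uk]; exists k => N; have [n Nn un] := uk N Logic.I; exists n.
apply: bigcupT_measurable => k; apply: bigcapT_measurable => N.
apply: bigcup_measurable => n _; rewrite -[X in measurable X]setTI.
apply: (@measurable_fun_ltr _ _ _ _ (cst (c + k.+1%:R^-1)) (fun w => erg_avg T xi w n)
  _ _ measurableT [set true]) => //.
exact: measurable_erg_avg.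
Qed.

(** The averages at [w] and at [T w] differ by a sequence tending to 0, and [often_gt] is
    insensitive to such a change. *)
Lemma limsup_gt_invariant (xi : Omega -> R) (M c : R) : measurable_fun setT xi ->
  (forall w, `|xi w| <= M) -> invariant_set T (limsup_gt T xi c).
Proof.
move=> mxi xiM; split; first exact: measurable_limsup_gt.
have sh w := erg_avg_shift _ M w xiM.
apply/seteqP; split => w; apply: often_gt_cvg0; first exact: sh.
have : - (erg_avg T xi (T w) n - erg_avg T xi w n) @[n --> \oo] --> - (0 : R).
  by apply: cvgN; exact: sh.
by rewrite oppr0; under eq_fun do rewrite opprB.
Qed.

Context (Q : probability Omega R) (iQ : T_invariant_prob T Q).

(** The maximal ergodic lemma applies to [(xi - c) 1_A]: an orbit starting in the invariant set [A]
    stays there, so its Birkhoff sums are [n] times the average of [xi] minus [c], and some of them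
    are positive. *)
Lemma integral_limsup_gt (xi : Omega -> R) (M c : R) (A : set Omega) :
  measurable_fun setT xi -> (forall w, `|xi w| <= M) ->
  invariant_set T A -> A `<=` limsup_gt T xi c ->
  Q.-integrable setT (EFin \o (fun w => (xi w - c) * \1_A w)) /\
  (0 <= \int[Q]_w ((xi w - c) * \1_A w)%:E)%E.
Proof.
move=> mxi xiM [mA TA] Ac.
have mf : measurable_fun setT (fun w => (xi w - c) * \1_A w).
  apply: measurable_funM; first exact: measurable_funB.
  exact: measurable_indic.
have fM w : `|(xi w - c) * \1_A w| <= M + `|c|.
  rewrite normrM (@le_trans _ _ `|xi w - c|)//.
    by rewrite ler_piMr// indicE; case: (_ \in _); rewrite ?normr1 ?normr0.
  by rewrite (le_trans (ler_normB _ _))// lerD.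
split; first exact: bounded_integrable mf fM.
apply: (maximal_ergodic _ mT _ mf _ fM _ iQ) => w.
have [Aw|nAw] := pselect (A w); last first.
  by rewrite indicE memNset// mulr0 eqxx.
(* Asking for [n >= 1] makes it possible to clear the factor [n^-1] of the average. *)
move=> _; have [k /(_ 1%N)[n n1 cn]] := Ac _ Aw; exists n.
have -> : \sum_(i < n) (xi (iter i T w) - c) * \1_A (iter i T w) =
    \sum_(i < n) xi (iter i T w) - n%:R * c.
  rewrite mulr_natl -[n in c *+ n]card_ord -sumr_const -sumrB.
  apply: eq_bigr => i _; rewrite indicE mem_set ?mulr1//.
  by rewrite -[A _]/((iter i T @^-1` A) w) preimage_iter_invariant.
have n0 : 0 < n%:R :> R by rewrite ltr0n.
rewrite subr_gt0 mulrC -ltr_pdivlMr// mulrC.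
by apply: le_lt_trans cn; rewrite lerDl invr_ge0.
Qed.

(** On [D] the integrands [xi - b] and [a - xi] both have nonnegative integral; their sum gives
    [(a - b) Q D >= 0] with [a - b < 0]. *)
Lemma oscillation_null (xi : Omega -> R) (M a b : R) :
  measurable_fun setT xi -> (forall w, `|xi w| <= M) -> a < b ->
  Q (limsup_gt T xi b `&` limsup_gt T (fun w => - xi w) (- a)) = 0%E.
Proof.
move=> mxi xiM ab; set D := _ `&` _.
have mNxi : measurable_fun setT (fun w => - xi w) by exact: measurableT_comp.
have NxiM w : `|- xi w| <= M by rewrite normrN.
have [mD1 TD1] := limsup_gt_invariant xi M b mxi xiM.
have [mD2 TD2] := limsup_gt_invariant _ M (- a) mNxi NxiM.
have iD : invariant_set T D.
  by split; [exact: measurableI|rewrite preimage_setI TD1 TD2].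
have [mD _] := iD.
have [i1 I1] := integral_limsup_gt _ _ _ _ mxi xiM iD (@subIsetl _ _ _).
have [i2 I2] := integral_limsup_gt _ _ _ _ mNxi NxiM iD (@subIsetr _ _ _).
have QD : Q D = (fine (Q D))%:E by rewrite fineK// fin_num_measure.
have : (0 <= (a - b)%:E * Q D)%E.
  have := adde_ge0 I1 I2; rewrite -integralD_EFin//.
  rewrite (_ : (fun w => _) = (fun w => ((a - b)%:E * (\1_D w)%:E)%E)).
    rewrite integralZl//; last exact: integrable_indic.
    by rewrite integral_indic// setIT.
  by apply/funext => w; rewrite -EFinD -EFinM; congr EFin; ring.
rewrite QD -EFinM lee_fin nmulr_rge0 ?subr_lt0// => QD0; congr EFin.
by apply/eqP; rewrite eq_le QD0 fine_ge0.
Qed.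

Lemma integral_ge_limsup_gt (xi : Omega -> R) (M c : R) :
  measurable_fun setT xi -> (forall w, `|xi w| <= M) ->
  (((c + M) * fine (Q (limsup_gt T xi c)) - M)%:E <= \int[Q]_w (xi w)%:E)%E.
Proof.
(* [xi >= (xi - c) 1_A + (c + M) 1_A - M] pointwise, for [A] the limsup set. *)
move=> mxi xiM; have iA := limsup_gt_invariant xi M c mxi xiM.
have [mA _] := iA; set A := limsup_gt T xi c in iA mA *.
have [i1 I1] := integral_limsup_gt _ _ _ _ mxi xiM iA (fun w Aw => Aw).
have icst := finite_measure_integrable_cst Q M measurableT.
have i1A : Q.-integrable setT (EFin \o (\1_A : Omega -> R)) by exact: integrable_indic.
have i2 : Q.-integrable setT (EFin \o (fun w => (c + M) * \1_A w)).
  exact: (integrableZl measurableT (c + M) i1A).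
have i3 := integrableB measurableT i2 icst.
have : (((c + M) * fine (Q A) - M)%:E <= \int[Q]_w ((xi w - c) * \1_A w)%:E +
    \int[Q]_w (((c + M) * \1_A w)%:E - M%:E))%E.
  apply: (le_trans _ (leeDr _ I1)); rewrite integralB_EFin// integral_cst//.
  have -> : (\int[Q]_w ((c + M) * \1_A w)%:E = (c + M)%:E * Q A)%E.
    under eq_integral do rewrite EFinM.
    by rewrite integralZl// integral_indic// setIT.
  rewrite [X in (M%:E * X)%E](_ : _ = 1%E); last exact: probability_setT.
  by rewrite mule1 EFinB EFinM fineK ?fin_num_measure.
move/le_trans; apply; rewrite -integralD//.
apply: le_integral => //; first exact: integrableD.
  exact: bounded_integrable mxi xiM.
move=> w _; rewrite /= -EFinB -EFinD lee_fin indicE.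
have := xiM w; rewrite ler_norml => /andP[? ?].
by case: (_ \in _); rewrite ?mulr1 ?mulr0; lra.
Qed.

End birkhoff.

(** * Transfer to members of the core, and use of ergodicity *)

Section upper_probability.
Context {d : measure_display} {Omega : measurableType d} {R : realType}.
Context (T : Omega -> Omega) (V : set Omega -> \bar R).
Context (mT : measurable_fun setT T) (upV : upper_probability V).
Context (cV : continuous_upper V) (iV : T_invariant_V T V).

(** The oscillation sets are null for an invariant [Q] that agrees with [P] on invariant sets; being
    invariant, they are [P]-null too. *)
Lemma cvgn_erg_avg_ae (P : probability Omega R) (xi : Omega -> R) (M : R) :
  core V P -> measurable_fun setT xi -> (forall w, `|xi w| <= M) ->
  {ae P, forall w, cvgn (erg_avg T xi w)}.
Proof.
move=> PV mxi xiM; have [Q [_ iQ] QP] := invariant_core _ _ mT P cV iV PV.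
pose D (a b : rat) := limsup_gt T xi (ratr b) `&`
  limsup_gt T (fun w => - xi w) (- ratr a).
have D0 a b : a < b -> {ae P, forall w, ~ D a b w}.
  move=> ab; have Nxi : measurable_fun setT (fun w => - xi w).
    exact: measurableT_comp.
  have NxiM w : `|- xi w| <= M by rewrite normrN.
  have [mD1 TD1] := limsup_gt_invariant _ mT xi M (ratr b) mxi xiM.
  have [mD2 TD2] := limsup_gt_invariant _ mT _ M (- ratr a) Nxi NxiM.
  have mD : measurable (D a b) by exact: measurableI.
  exists (D a b); split => //; last by move=> w /= /contrapT.
  rewrite -QP; last by split => //; rewrite preimage_setI TD1 TD2.
  by apply: (oscillation_null _ mT _ iQ _ _ _ _ mxi xiM); rewrite ltr_rat.
(* Enumerating the rational pairs by [unpickle] reduces to a countable intersection indexed by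
   [nat]. *)
have : {ae P, forall w, forall n (a b : rat),
    unpickle n = Some (a, b) -> a < b -> ~ D a b w}.
  apply: ae_foralln => n.
  case: (unpickle n) => [[a b]|]; last by apply: aeW => w.
  have [ab|ab] := boolP (a < b).
    by apply: filterS (D0 a b ab) => w nD _ _ [<- <-].
  by apply: aeW => w a' b' [<- <-]; rewrite (negbTE ab).
apply: filterS => w nD; apply: (@bounded_not_often_cvg _ _ M) => [n|a b ab [ub ua]].
  exact: erg_avg_le.
apply: (nD (pickle (a, b)) a b _ ab); first by rewrite pickleK.
split=> //; move: ua; rewrite /limsup_gt/=.
by under eq_fun do rewrite -erg_avgN.
Qed.

Lemma limsup_gt_E0_null (xi : Omega -> R) (M c : R) :
  T_ergodic T V -> measurable_fun setT xi -> (forall w, `|xi w| <= M) ->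
  (E0 T V xi < c%:E)%E -> V (limsup_gt T xi c) = 0%E.
Proof.
move=> eV mxi xiM E0c; have iA := limsup_gt_invariant _ mT xi M c mxi xiM.
have [//|VA1] := eV _ iA; set A := limsup_gt T xi c in iA VA1 *.
have E0_ge P : core V P -> (((c + M) * fine (P A) - M)%:E <= E0 T V xi)%E.
  move=> PV; have [Q Q0 QP] := invariant_core _ _ mT P cV iV PV.
  rewrite -(QP _ iA); apply: le_trans (integral_ge_limsup_gt _ mT _ Q0.2 _ _ c mxi xiM) _.
  by apply: ereal_sup_ubound; exists Q.
have [mA _] := iA.
(* The supremum 1 need not be attained, so it is only approached from below. *)
have coreP x : (x%:E < 1)%E -> exists2 P, core V P & (x%:E < P A)%E.
  rewrite -VA1 upV// => /ereal_sup_gt[_ [P PV <-] xP].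
  by exists P.
have [P0 P0V _] := coreP 0 lte01.
(* [E0 T V xi] is finite: it is below [c], and [E0_ge] bounds it from below by a real number. *)
have [e Ee] : exists e, E0 T V xi = e%:E.
  have := E0_ge _ P0V; move: E0c; case: (E0 T V xi) => // e _ _.
  by exists e.
exfalso; move: E0c E0_ge; rewrite Ee lte_fin => ec E0_ge.
(* If [c + M <= 0], then [P0 A <= 1] alone gives [(c + M) P0 A - M >= c], contradicting [e < c]. *)
have [cM0|cM0] := leP (c + M) 0.
  have := E0_ge _ P0V; rewrite lee_fin.
  have /andP[p0 p1] := fine_probability_le1 _ _ _ P0 _ mA.
  nra.
(* This threshold is the mass [x] solving [(c + M) x - M = e]; any larger mass of [A] contradicts
   [E0_ge]. *)
have xlt1 : ((1 - (c - e) / (c + M))%:E < 1)%E.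
  by rewrite lte_fin ltrBlDr ltrDl divr_gt0// subr_gt0.
have [P PV xP] := coreP _ xlt1.
have := E0_ge _ PV; rewrite lee_fin => E0P.
have : 1 - (c - e) / (c + M) < fine (P A).
  by rewrite -lte_fin fineK// fin_num_measure.
rewrite -(ltr_pM2l cM0) mulrBr mulr1 mulrCA divff ?gt_eqF// mulr1.
lra.
Qed.

(** A limit above [E0 T V xi] would exceed some rational [c] above [E0 T V xi], placing [w] in one
    of countably many null limsup sets. *)
Lemma limn_le_E0 (P : probability Omega R) (xi : Omega -> R) (M : R) :
  T_ergodic T V -> core V P -> measurable_fun setT xi ->
  (forall w, `|xi w| <= M) ->
  {ae P, forall w, cvgn (erg_avg T xi w) ->
    ((limn (erg_avg T xi w))%:E <= E0 T V xi)%E}.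
Proof.
move=> eV PV mxi xiM.
have : {ae P, forall w, forall n (c : rat), unpickle n = Some c ->
    (E0 T V xi < (ratr c)%:E)%E -> ~ limsup_gt T xi (ratr c) w}.
  apply: ae_foralln => n.
  case: (unpickle n) => [c|]; last by apply: aeW => w.
  have [E0c|E0c] := boolP (E0 T V xi < (ratr c)%:E)%E; last first.
    by apply: aeW => w c' [<-]; rewrite (negbTE E0c).
  have mA := measurable_limsup_gt _ mT xi (ratr c) mxi.
  exists (limsup_gt T xi (ratr c)); split => //.
    apply/eqP; rewrite eq_le measure_ge0 andbT.
    by rewrite -(limsup_gt_E0_null xi M (ratr c))//; exact: PV.
  by move=> w /= h; apply: contrapT => nA; apply: h => _ [<-] _.
apply: filterS => w nA cvw; rewrite leNgt; apply/negP => E0l.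
have [c E0c cl] : exists2 c : rat,
    (E0 T V xi < (ratr c)%:E)%E & ratr c < limn (erg_avg T xi w).
  move: E0l; case: (E0 T V xi) => [e el| |_].
  - have [c] := @rat_in_itvoo R _ _ el; rewrite in_itv/= => /andP[ec cl].
    by exists c; rewrite ?lte_fin.
  - by rewrite ltNge leey.
  - have [|c] := @rat_in_itvoo R (limn (erg_avg T xi w) - 1) (limn (erg_avg T xi w)).
      by rewrite ltrBlDr ltrDl.
    by rewrite in_itv/= => /andP[_ cl]; exists c; rewrite ?ltNyr.
apply: (nA (pickle c) c _ E0c); first by rewrite pickleK.
exact: cvg_often_gt cvw cl.
Qed.

End upper_probability.

Theorem theorem3p4 (d : measure_display) (Omega : measurableType d) (R : realType)
  (T : Omega -> Omega) (V : set Omega -> \bar R) :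
  measurable_fun setT T ->
  upper_probability V ->
  continuous_upper V ->
  T_invariant_V T V ->
  T_ergodic T V ->
  forall (P : probability Omega R), core V P ->
  forall xi : Omega -> R, measurable_fun setT xi ->
  (exists M : R, forall w, `|xi w| <= M) ->
  {ae P, forall w, cvgn (erg_avg T xi w) /\
     (- E0 T V (fun x => (- xi x)%R) <= (limn (erg_avg T xi w))%:E <= E0 T V xi)%E}.
Proof.
move=> mT upV cV iV eV P PV xi mxi [M xiM].
have mNxi : measurable_fun setT (fun w => - xi w) by exact: measurableT_comp.
have NxiM w : `|- xi w| <= M by rewrite normrN.
have cvgP := cvgn_erg_avg_ae _ _ mT cV iV _ _ _ PV mxi xiM.
have ub := limn_le_E0 _ _ mT upV cV iV _ _ _ eV PV mxi xiM.
(* The lower bound is the upper bound for [- xi], negated. *)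
have lb := limn_le_E0 _ _ mT upV cV iV _ _ _ eV PV mNxi NxiM.
apply: filterS3 cvgP ub lb => w cw /(_ cw) ubw lbw; split=> //.
rewrite ubw andbT leeNl -EFinN.
have cNw : erg_avg T (fun x => - xi x) w @ \oo --> - limn (erg_avg T xi w).
  rewrite (_ : erg_avg _ _ w = fun n => - erg_avg T xi w n); first exact: cvgN.
  by apply/funext => n; exact: erg_avgN.
have <- := cvg_lim (@Rhausdorff R) cNw.
by apply: lbw; apply/cvg_ex; eexists; exact: cNw.
Qed.
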